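(* Let $T>0$, $\lambda>0$, let $U,f,h$ satisfy the standing assumptions (A1)-(A5) listed in the context, and put $\tilde H(\tau,x,p)=H(T-\tau,x,p)$ with $H(t,x,p)=\inf_{u\in U}\{h(t,x,u)+p\cdot f(x,u)\}$. Let $X\subset\mathbb{R}^n$ be compact and $\mathcal D=[0,T]\times X$. Let $W_\lambda$ be the unique bounded, uniformly continuous viscosity solution on $[0,T]\times\mathbb{R}^n$ of $$\partial_\tau W_\lambda(\tau,x)=\tilde H\big(\tau,x,\nabla_xW_\lambda(\tau,x)\big)-\lambda W_\lambda(\tau,x),\qquad W_\lambda(0,x)=0.$$ Let $\widehat W:\mathcal D\to\mathbb{R}$ be bounded and uniformly continuous, and suppose there are $\varepsilon_{\mathrm{pde}}\ge0$ and $\varepsilon_0\ge0$ such that: (i) for every $\phi\in C^1([0,T]\times\mathbb{R}^n)$ and every $(\tau_0,x_0)\in(0,T]\times X$ with $\phi(\tau_0,x_0)=\widehat W(\tau_0,x_0)$: if $\widehat W-\phi$ has a local maximum at $(\tau_0,x_0)$, then $$\partial_\tau\phi(\tau_0,x_0)-\tilde H(\tau_0,x_0,\nabla_x\phi(\tau_0,x_0))+\lambda\phi(\tau_0,x_0)\le\varepsilon_{\mathrm{pde}},$$ and if $\widehat W-\phi$ has a local minimum at $(\tau_0,x_0)$, then $$\partial_\tau\phi(\tau_0,x_0)-\tilde H(\tau_0,x_0,\nabla_x\phi(\tau_0,x_0))+\lambda\phi(\tau_0,x_0)\ge-\varepsilon_{\mathrm{pde}};$$ (ii) $\sup_{x\in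 X}|\widehat W(0,x)|\le\varepsilon_0$. Set $\varepsilon_{\mathrm{val}}=\max\{\varepsilon_{\mathrm{pde}}/\lambda,\ \varepsilon_0\}$. Then $$\widehat W(\tau,x)-\varepsilon_{\mathrm{val}}\le W_\lambda(\tau,x)\le\widehat W(\tau,x)+\varepsilon_{\mathrm{val}}\qquad\text{for all }(\tau,x)\in\mathcal D,$$ and in particular $\|\widehat W-W_\lambda\|_{L^\infty(\mathcal D)}\le\varepsilon_{\mathrm{val}}$.
   Context: Standing assumptions. (A1) $U\subset\mathbb{R}^m$ is nonempty and compact. (A2) There is $L_f>0$ with $\|f(x_1,u)-f(x_2,u)\|\le L_f\|x_1-x_2\|$ for all $x_1,x_2\in\mathbb{R}^n$, $u\in U$, where $f:\mathbb{R}^n\times U\to\mathbb{R}^n$. (A3) There is $M_f>0$ with $\|f(x,u)\|\le M_f$ for all $(x,u)\in\mathbb{R}^n\times U$. (A4) For each $x$, $u\mapsto f(x,u)$ is continuous on $U$. (A5) $h:[0,T]\times\mathbb{R}^n\times U\to\mathbb{R}$ is measurable and: (i) there is $L_h>0$ with $|h(t,x_1,u)-h(t,x_2,u)|\le L_h\|x_1-x_2\|$ for all $t,x_1,x_2,u$; (ii) there is $M_h>0$ with $|h(t,x,u)|\le M_h$ for all $(t,x,u)$; (iii) for each $(t,x)$, $u\mapsto h(t,x,u)$ is continuous on $U$; (iv) for every compact $K\subset\mathbb{R}^n$, $\lim_{\delta\to0^+}\sup_{t\in[0,T-\delta],\,x\in K,\,u\in U}|h(t+\delta,x,u)-h(t,x,u)|=0$.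 Viscosity convention for $W_\lambda$: $W_\lambda(0,\cdot)=0$ and, for $\phi\in C^1([0,T]\times\mathbb{R}^n)$, if $W_\lambda-\phi$ has a local maximum (resp. minimum) equal to $0$ at $(\tau_0,x_0)\in(0,T)\times\mathbb{R}^n$, then $\partial_\tau\phi-\tilde H(\tau_0,x_0,\nabla_x\phi)+\lambda\phi\le0$ (resp. $\ge0$) at $(\tau_0,x_0)$. Under (A1)-(A5) this solution is the value function $W_\lambda(\tau,x)=\inf_{u}\int_0^\tau e^{-\lambda r}h(T-\tau+r,y(r),u(r))\,dr$, the infimum over measurable $u:[0,\tau]\to U$ with $y'=f(y,u)$, $y(0)=x$. In (i), $\widehat W-\phi$ is regarded as a function on $\mathcal D$, the domain of $\widehat W$, so local extrema are local extrema of this function on $\mathcal D$. *)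

(* Defs.v *)
From HB Require Import structures.
From mathcomp Require Export all_boot all_order all_algebra.
From mathcomp Require Export all_classical all_reals all_analysis.
Export Order.TTheory GRing.Theory Num.Theory.
Export numFieldNormedType.Exports.

Set Implicit Arguments.
Unset Strict Implicit.
Unset Printing Implicit Defensive.

Local Open Scope classical_set_scope.
Local Open Scope ring_scope.

(* The norm the library puts on 'rV[R]_n is the sup norm; [enorm] is the
   Euclidean one.  Both induce the library's topology. *)
Definition dotv (R : realType) (n : nat) (u v : 'rV[R]_n) : R :=
  \sum_(i < n) u ord0 i * v ord0 i.

Definition enorm (R : realType) (n : nat) (u : 'rV[R]_n) : R :=
  Num.sqrt (dotv u u).

Section ControlProblem.
Context (R : realType) (n m : nat).
Implicit Types (T lambda : R) (U : set 'rV[R]_m) (X : set 'rV[R]_n).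
Implicit Types (f : 'rV[R]_n -> 'rV[R]_m -> 'rV[R]_n).
Implicit Types (h : R -> 'rV[R]_n -> 'rV[R]_m -> R).
Implicit Types (phi g : R * 'rV[R]_n -> R) (z : R * 'rV[R]_n).

(* Borel measurability on [0, T] x R^n x U; the source is equipped with the
   sigma-algebra generated by the open sets of the product topology. *)
Definition borel_on_domain T U h : Prop :=
  @measurable_fun _ _
    (g_sigma_algebraType (@open (R * 'rV[R]_n * 'rV[R]_m)%type)) R
    ((`[0, T] `*` setT) `*` U) (fun q => h q.1.1 q.1.2 q.2).

(* f and h are total functions; their values outside R^n x U, respectively
   [0, T] x R^n x U, are never constrained. *)
Record standing_assumptions T U f h : Prop := StandingAssumptions {
  U_nonempty : U !=set0 ;
  U_compact : compact U ;
  f_lipschitz : exists2 Lf : R, 0 < Lf &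
    forall x1 x2 u, U u -> enorm (f x1 u - f x2 u) <= Lf * enorm (x1 - x2) ;
  f_bounded : exists2 Mf : R, 0 < Mf & forall x u, U u -> enorm (f x u) <= Mf ;
  f_continuous : forall x, {within U, continuous (f x)} ;
  h_measurable : borel_on_domain T U h ;
  h_lipschitz : exists2 Lh : R, 0 < Lh &
    forall (t : R) x1 x2 u, t \in `[0, T] -> U u ->
      `|h t x1 u - h t x2 u| <= Lh * enorm (x1 - x2) ;
  h_bounded : exists2 Mh : R, 0 < Mh &
    forall (t : R) x u, t \in `[0, T] -> U u -> `|h t x u| <= Mh ;
  h_continuous : forall (t : R) x, t \in `[0, T] ->
    {within U, continuous (h t x)} ;
  h_time_modulus : forall K : set 'rV[R]_n, compact K ->
    sup [set r | exists (t : R) x u, [/\ t \in `[0, T - delta], K x, U u &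
                   r = `|h (t + delta) x u - h t x u| ]]
      @[delta --> 0^'+] --> (0 : R)
}.

Definition hamiltonian U f h (t : R) (x p : 'rV[R]_n) : R :=
  inf [set h t x u + dotv p (f x u) | u in U].

Definition hamiltonian_rev T U f h (tau : R) (x p : 'rV[R]_n) : R :=
  hamiltonian U f h (T - tau) x p.

Definition cylinder T X : set (R * 'rV[R]_n) := `[0, T] `*` X.

Definition time_quotient phi z (s : R) : R :=
  (s - z.1)^-1 * (phi (s, z.2) - phi z).

(* Derivative in time relative to [0, T]: one-sided at 0 and at T. *)
Definition dtime T phi z : R :=
  lim (time_quotient phi z s @[s --> within `[0, T] z.1^']).

Definition grad phi z : 'rV[R]_n :=
  \row_i 'D_(delta_mx ord0 i) (fun y => phi (z.1, y)) z.2.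

(* C^1 on the closed strip [0, T] x R^n; phi is total, but only its values on
   the strip matter. *)
Definition C1_strip T phi : Prop :=
  [/\ forall z, cylinder T setT z ->
        cvg (time_quotient phi z s @[s --> within `[0, T] z.1^']),
      forall z i, cylinder T setT z ->
        derivable (fun y => phi (z.1, y)) z.2 (delta_mx ord0 i),
      {within cylinder T setT, continuous (dtime T phi)} &
      {within cylinder T setT, continuous (grad phi)}].

Definition local_max_on (A : set (R * 'rV[R]_n)) g z0 : Prop :=
  \forall z \near z0, A z -> g z <= g z0.

Definition local_min_on (A : set (R * 'rV[R]_n)) g z0 : Prop :=
  \forall z \near z0, A z -> g z0 <= g z.

Definition pde_residual T lambda U f h phi z : R :=
  dtime T phi z - hamiltonian_rev T U f h z.1 z.2 (grad phi z)
  + lambda * phi z.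

(* Uniform continuity is that of the restriction to A: [subspace A] carries the
   induced uniformity on A. *)
Definition bounded_unif_continuous (A : set (R * 'rV[R]_n)) g : Prop :=
  [bounded g z | z in A] /\ unif_continuous (g : subspace A -> R).

Definition viscosity_solution T lambda U f h (W : R * 'rV[R]_n -> R) : Prop :=
  (forall x, W (0, x) = 0) /\
  forall phi z0, C1_strip T phi -> z0.1 \in `]0, T[ -> phi z0 = W z0 ->
    (local_max_on (cylinder T setT) (fun z => W z - phi z) z0 ->
       pde_residual T lambda U f h phi z0 <= 0) /\
    (local_min_on (cylinder T setT) (fun z => W z - phi z) z0 ->
       0 <= pde_residual T lambda U f h phi z0).

(* Sets of Lebesgue measure zero in R x R^n, through countable covers by closed
   boxes. *)
Definition box (a b : R * 'rV[R]_n) : set (R * 'rV[R]_n) :=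
  [set z : R * 'rV[R]_n | a.1 <= z.1 <= b.1 /\
           forall i, a.2 ord0 i <= z.2 ord0 i <= b.2 ord0 i].

Definition box_volume (a b : R * 'rV[R]_n) : R :=
  (b.1 - a.1) * \prod_(i < n) (b.2 ord0 i - a.2 ord0 i).

Definition lebesgue_null (A : set (R * 'rV[R]_n)) : Prop :=
  forall e : R, 0 < e -> exists a b : nat -> R * 'rV[R]_n,
    [/\ forall k, (a k).1 <= (b k).1 /\
                  forall i, (a k).2 ord0 i <= (b k).2 ord0 i,
        A `<=` \bigcup_k box (a k) (b k) &
        (\sum_(0 <= k <oo) (box_volume (a k) (b k))%:E <= e%:E)%E].

Definition Linfty_norm (A : set (R * 'rV[R]_n)) g : \bar R :=
  ereal_inf [set c%:E | c in
    [set c : R | 0 <= c /\ lebesgue_null [set z | A z /\ c < `|g z|]]].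

End ControlProblem.

(* Main.v *)
(* Doubling of variables. What is tested at (tau, x) in [0, T] x X and W at
   (s, y) in [0, T] x R^n by maximising
     What(tau, x) - W(s, y) - k ((tau - s - d)^2 + |x - y|^2).
   As W solves its equation for every y in R^n and What may be tested at every x
   in X, boundary points included, no boundary data on X is needed.  At a
   maximiser with s > 0 both test functions have the same time derivative and
   the same gradient p = 2k (x - y), so subtracting the two inequalities leaves
     lambda (What - W) <= eps_pde + (modulus of the Hamiltonian),
   where |p| |x - y| = 2k |x - y|^2 is small because W is uniformly continuous.
   If s = 0, the initial bound is used.  Exchanging the roles, (-What, -W) solve
   the same kind of problem for the Hamiltonian -H(t, x, -p). *)

Require Import Defs.
From mathcomp Require Import ring lra.

Set Implicit Arguments.
Unset Strict Implicit.
Unset Printing Implicit Defensive.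

Local Open Scope classical_set_scope.
Local Open Scope ring_scope.

(** * Euclidean inner product and norm on row vectors *)

Section Euclidean.
Context (R : realType) (n : nat).
Implicit Types u v w x : 'rV[R]_n.

Lemma dotvC u v : dotv u v = dotv v u.
Proof. by apply: eq_bigr => i _; rewrite mulrC. Qed.

Lemma dotvDl u v w : dotv (u + v) w = dotv u w + dotv v w.
Proof. by rewrite -big_split; apply: eq_bigr => i _; rewrite !mxE mulrDl. Qed.

Lemma dotvZl a u v : dotv (a *: u) v = a * dotv u v.
Proof. by rewrite mulr_sumr; apply: eq_bigr => i _; rewrite !mxE mulrA. Qed.

Lemma dotvDr u v w : dotv u (v + w) = dotv u v + dotv u w.
Proof. by rewrite !(dotvC u) dotvDl. Qed.

Lemma dotvZr a u v : dotv u (a *: v) = a * dotv u v.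
Proof. by rewrite !(dotvC u) dotvZl. Qed.

Lemma dotvBr u v w : dotv u (v - w) = dotv u v - dotv u w.
Proof. by rewrite -scaleN1r dotvDr dotvZr mulN1r. Qed.

Lemma dotv0 u : dotv u 0 = 0.
Proof. by rewrite /dotv big1// => i _; rewrite mxE mulr0. Qed.

Lemma enorm0 : enorm (0 : 'rV[R]_n) = 0.
Proof. by rewrite /enorm dotv0 sqrtr0. Qed.

Lemma dotvv_ge0 u : 0 <= dotv u u.
Proof. by apply: sumr_ge0 => i _; rewrite -expr2 sqr_ge0. Qed.

Lemma enorm_ge0 u : 0 <= enorm u.
Proof. exact: sqrtr_ge0. Qed.

Lemma enorm_sqr u : enorm u ^+ 2 = dotv u u.
Proof. by rewrite sqr_sqrtr // dotvv_ge0. Qed.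

Lemma enormZ a u : enorm (a *: u) = `|a| * enorm u.
Proof.
by rewrite /enorm dotvZl dotvZr mulrA -expr2 sqrtrM ?sqr_ge0// sqrtr_sqr.
Qed.

Lemma enormN u : enorm (- u) = enorm u.
Proof. by rewrite -scaleN1r enormZ normrN1 mul1r. Qed.

(** Cauchy-Schwarz by the discriminant argument: [t |-> |u + t v|^2] is a nonnegative quadratic
    polynomial in [t]. *)
Lemma dotv_le_enorm u v : `|dotv u v| <= enorm u * enorm v.
Proof.
have disc t : 0 <= dotv u u + 2 * t * dotv u v + t ^+ 2 * dotv v v.
  have := dotvv_ge0 (u + t *: v).
  rewrite dotvDl !dotvDr !dotvZl !dotvZr (dotvC v u).
  by rewrite [leRHS](_ : _ = dotv u u + 2 * t * dotv u v + t ^+ 2 * dotv v v) //; ring.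
rewrite -ler_sqr ?nnegrE ?mulr_ge0 ?enorm_ge0// exprMn !enorm_sqr.
rewrite real_normK ?num_real//.
have [v0|v0] := eqVneq (dotv v v) 0.
  have uv0 : dotv u v = 0.
    apply/eqP/negPn/negP => uv.
    (* With [dotv v v = 0] the polynomial is affine of nonzero slope; at this [t] it would equal
       -1. *)
    have := disc (- (dotv u u + 1) / (2 * dotv u v)).
    rewrite v0 mulr0 addr0.
    rewrite (_ : 2 * _ * _ = - (dotv u u + 1)); first by lra.
    by field; rewrite uv.
  by rewrite uv0 v0 mulr0 expr0n.
have vgt0 : 0 < dotv v v by rewrite lt_neqAle eq_sym v0 dotvv_ge0.
(* The minimiser of the quadratic polynomial. *)
have := disc (- dotv u v / dotv v v).
rewrite (_ : dotv u u + _ + _ =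
  (dotv u u * dotv v v - dotv u v ^+ 2) / dotv v v); last by field.
by rewrite pmulr_lge0 ?invr_gt0// subr_ge0.
Qed.

Lemma coord_le_enorm u i : `|u ord0 i| <= enorm u.
Proof.
rewrite -ler_sqr ?nnegrE ?enorm_ge0// enorm_sqr real_normK ?num_real//.
rewrite /dotv (bigD1 i)//= expr2 lerDl; apply: sumr_ge0 => j _.
by rewrite -expr2 sqr_ge0.
Qed.

Lemma norm_le_enorm u : `|u| <= enorm u.
Proof.
rewrite /Num.norm/= mx_normrE; apply: bigmax_le; first exact: enorm_ge0.
by move=> [i j] _ /=; rewrite (ord1 i) coord_le_enorm.
Qed.

Lemma dotv_add_delta u i r :
  dotv (u + r *: delta_mx ord0 i) (u + r *: delta_mx ord0 i) =
  dotv u u + r * (2 * u ord0 i + r).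
Proof.
have dotd x : dotv (delta_mx ord0 i) x = x ord0 i.
  rewrite /dotv (bigD1 i)//= big1 ?addr0 => [|j ji].
    by rewrite mxE !eqxx mul1r.
  by rewrite mxE (negPf ji) andbF mul0r.
rewrite dotvDl !dotvDr !dotvZl !dotvZr !(dotvC u) !dotd !mxE !eqxx /=.
by ring.
Qed.

Lemma continuous_dotvv (S : topologicalType) (F : set_system S)
    (FF : Filter F) (g : S -> 'rV[R]_n) l :
  g @ F --> l -> dotv (g s) (g s) @[s --> F] --> dotv l l.
Proof.
move=> gl; apply: cvg_big => [|i _]; first exact: add_continuous.
have gi : (g s) ord0 i @[s --> F] --> l ord0 i.
  exact: (cvg_comp _ _ gl (@coord_continuous _ _ _ _ _ _)).
exact: (cvgM gi gi).
Qed.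

End Euclidean.

(** * Boundedness and uniform continuity on a subset, in epsilon-delta form *)

Lemma unif_continuous_continuous (V W : uniformType) (g : V -> W) :
  unif_continuous g -> continuous g.
Proof.
move=> gu x; apply/cvg_app_entourageP => E /gu entE.
by have := nbhs_entourage x entE; apply: filterS => y /xsectionP.
Qed.

Section Functions.
Context (R : realType) (n : nat).
Implicit Types (A : set (R * 'rV[R]_n)) (g : R * 'rV[R]_n -> R).

Lemma bounded_onP A g : [bounded g z | z in A] ->
  exists2 M : R, 0 < M & forall z, A z -> `|g z| <= M.
Proof. by move=> /pinfty_ex_gt0[M M0 gM]; exists M. Qed.

Lemma unif_continuous_onP A g : unif_continuous (g : subspace A -> R) ->
  forall e, 0 < e -> exists2 d : R, 0 < d & forall z w, A z -> A w ->
    `|z.1 - w.1| < d -> enorm (z.2 - w.2) < d -> `|g z - g w| < e.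
Proof.
move=> /unif_continuousP gu e /gu[d d0 gd]; exists d => // z w Az Aw zw1 zw2.
apply: (gd (z, w)); rewrite ball_subspace_ball /subspace_ball/= mem_set//=.
split=> //; split; first by [].
by rewrite -ball_normE /=; exact: le_lt_trans (norm_le_enorm _) zw2.
Qed.

End Functions.

(** * Quadratic test functions on the strip and their derivatives *)

Section QuadraticTest.
Context (R : realType) (n : nat) (T : R).
Hypothesis T0 : 0 < T.
Implicit Types (z w : R * 'rV[R]_n) (c k : R).

Definition sqdist z w : R :=
  (z.1 - w.1) ^+ 2 + dotv (z.2 - w.2) (z.2 - w.2).

Lemma sqdist_ge0 z w : 0 <= sqdist z w.
Proof. by rewrite addr_ge0 ?sqr_ge0 ?dotvv_ge0. Qed.

Lemma sqdist_same_point z w : z.2 = w.2 -> sqdist z w = (z.1 - w.1) ^+ 2.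
Proof. by rewrite /sqdist => ->; rewrite subrr dotv0 addr0. Qed.

(** Properness of this filter makes the limit defining [dtime] unique, also at the two ends of the
    interval. *)
Lemma within_dnbhs_proper (t : R) : t \in `[0, T] ->
  ProperFilter (within `[0, T] t^').
Proof.
rewrite in_itv/= => /andP[t0 tT].
split; last exact: within_filter.
move=> /(@nbhs_ballP R R)[e /= e0 te].
(* Step right by [e / 2], truncated at [T]; if [t = T], step left, truncated at 0. Since [0 < T],
   the result differs from [t]. *)
pose s := if t < T then Num.min T (t + e / 2) else Num.max 0 (t - e / 2).
have [st s0T se] : [/\ s != t, s \in `[0, T] & `|t - s| < e].
  rewrite /s in_itv/=; case: (ltP t T) => tT'.
    rewrite minElt; case: ifPn => h.
      split; [by rewrite gt_eqF| by apply/andP; split; lra|].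
      by rewrite ltr_norml; apply/andP; split; lra.
    split; [by rewrite gt_eqF// ltrDl; lra| by apply/andP; split; lra|].
    by rewrite ltr_norml; apply/andP; split; lra.
  have tgt0 : 0 < t by exact: lt_le_trans T0 tT'.
  rewrite maxElt; case: ifPn => h.
    split; [by rewrite lt_eqF//; lra| by apply/andP; split; lra|].
    by rewrite ltr_norml; apply/andP; split; lra.
  split; [by rewrite lt_eqF| by apply/andP; split; lra|].
  by rewrite ltr_norml; apply/andP; split; lra.
exact: (te s se st s0T).
Qed.

Lemma time_quotient_quadratic c k w z : z.1 \in `[0, T] ->
  time_quotient (fun x => c + k * sqdist x w) z s @[s --> within `[0, T] z.1^']
    --> 2 * k * (z.1 - w.1).
Proof.
move=> zT; have PF := within_dnbhs_proper zT.
have lin : k * (s + z.1 - 2 * w.1) @[s --> within `[0, T] z.1^']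
    --> 2 * k * (z.1 - w.1).
  rewrite (_ : 2 * k * _ = k * (z.1 + z.1 - 2 * w.1)); last by ring.
  have idz : s @[s --> within `[0, T] z.1^'] --> z.1.
    exact: (cvg_trans (@cvg_within _ _ _ _) (@nbhs_dnbhs _ _)).
  apply: cvgM; [exact: cvg_cst|].
  apply: cvgB; last exact: cvg_cst.
  by apply: cvgD => //; exact: cvg_cst.
apply: cvg_trans lin; apply: near_eq_cvg.
near=> s; rewrite /time_quotient /sqdist /=.
have sz : s - z.1 != 0.
  by rewrite subr_eq0; near: s; apply: cvg_within; exact: withinT.
by field.
Unshelve. all: by end_near. Qed.

Lemma dtime_quadratic c k w z : z.1 \in `[0, T] ->
  dtime T (fun x => c + k * sqdist x w) z = 2 * k * (z.1 - w.1).
Proof.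
move=> zT; have PF := within_dnbhs_proper zT.
by apply: cvg_lim => //; exact: time_quotient_quadratic.
Qed.

Lemma partial_quotient_quadratic c k w z (i : 'I_n) :
  r^-1 *: ((c + k * sqdist (z.1, r *: delta_mx ord0 i + z.2) w) -
           (c + k * sqdist z w)) @[r --> 0^'] -->
  2 * k * (z.2 - w.2) ord0 i.
Proof.
have lin : k * (2 * (z.2 - w.2) ord0 i + r) @[r --> (0 : R)^']
    --> 2 * k * (z.2 - w.2) ord0 i.
  rewrite [X in _ --> X](_ : _ = k * (2 * (z.2 - w.2) ord0 i + 0)); last by ring.
  apply: cvgM; [exact: cvg_cst|]; apply: cvgD; first exact: cvg_cst.
  exact: nbhs_dnbhs.
apply: cvg_trans lin; apply: near_eq_cvg.
near=> r; rewrite /sqdist /=.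
rewrite (_ : r *: _ + z.2 - w.2 = z.2 - w.2 + r *: delta_mx ord0 i); last first.
  by rewrite -addrA addrC.
rewrite dotv_add_delta /GRing.scale/=.
have r0 : r != 0 by near: r; exact: nbhs_dnbhs_neq.
by field.
Unshelve. all: by end_near. Qed.

Lemma grad_quadratic c k w z :
  grad (fun x => c + k * sqdist x w) z = (2 * k) *: (z.2 - w.2).
Proof.
apply/rowP => i; rewrite !mxE; apply: cvg_lim => //.
have := @partial_quotient_quadratic c k w z i.
by rewrite !mxE.
Qed.

Lemma C1_strip_quadratic c k w : C1_strip T (fun x => c + k * sqdist x w).
Proof.
split.
- move=> z [zT _]; apply/cvg_ex; exists (2 * k * (z.1 - w.1)).
  exact: time_quotient_quadratic.
- move=> z i _; apply/cvg_ex; exists (2 * k * (z.2 - w.2) ord0 i).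
  exact: partial_quotient_quadratic.
- apply: (@subspace_eq_continuous _ _ _
    (fun z : subspace (cylinder T setT) => 2 * k * (z.1 - w.1))).
    by move=> z; rewrite inE => -[zT _]; exact/esym/dtime_quadratic.
  apply: continuous_subspaceT => z; apply: cvgM; [exact: cvg_cst|].
  apply: cvgB; last exact: cvg_cst.
  exact: cvg_fst.
- rewrite (_ : grad _ = fun z => (2 * k) *: (z.2 - w.2)); last first.
    by apply/funext => z; rewrite grad_quadratic.
  apply: continuous_subspaceT => z; apply: cvgZr; apply: cvgB; last exact: cvg_cst.
  exact: cvg_snd.
Qed.

End QuadraticTest.

(** * Modulus of continuity of the Hamiltonian *)

Lemma inf_image_dist (R : realType) (V : Type) (U : set V) (a b : V -> R)
    (c : R) :
  U !=set0 -> has_lbound (a @` U) -> has_lbound (b @` U) ->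
  (forall u, U u -> `|a u - b u| <= c) ->
  `|inf (a @` U) - inf (b @` U)| <= c.
Proof.
have half (a' b' : V -> R) : U !=set0 -> has_lbound (a' @` U) ->
    (forall u, U u -> `|a' u - b' u| <= c) -> inf (a' @` U) - c <= inf (b' @` U).
  move=> [u0 Uu0] alb ab; apply: lb_le_inf; first by exists (b' u0); exists u0.
  move=> _ [u Uu <-]; have := ab u Uu; rewrite ler_norml => /andP[_].
  have : inf (a' @` U) <= a' u by apply: ge_inf => //; exists u.
  lra.
move=> U0 alb blb ab.
have := half a b U0 alb ab.
have /(half b a U0 blb) : forall u, U u -> `|b u - a u| <= c.
  by move=> u /ab; rewrite distrC.
by rewrite ler_norml => *; apply/andP; split; lra.
Qed.

Section Hamiltonian.
Context (R : realType) (n m : nat) (T : R) (U : set 'rV[R]_m)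
  (f : 'rV[R]_n -> 'rV[R]_m -> 'rV[R]_n)
  (h : R -> 'rV[R]_n -> 'rV[R]_m -> R).
Hypothesis hyp : standing_assumptions T U f h.

(** Turns the limit of suprema over forward time shifts into a symmetric modulus, ordering the two
    times and shifting from the earlier one. *)
Lemma h_time_modulus_unif (K : set 'rV[R]_n) : compact K ->
  forall e, 0 < e -> exists2 d : R, 0 < d & forall (t s : R) x u,
    t \in `[0, T] -> s \in `[0, T] -> `|t - s| < d -> K x -> U u ->
    `|h t x u - h s x u| <= e.
Proof.
move=> cK e e0; have [Mh Mh0 hM] := h_bounded hyp.
have /cvgrPdist_lt/(_ e e0)/(@nbhs_ballP R R)[d /= d0 hd] :=
  h_time_modulus hyp cK.
have lt_case (t s : R) x u : t \in `[0, T] -> s \in `[0, T] -> s < t ->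
    t - s < d -> K x -> U u -> `|h t x u - h s x u| <= e.
  move=> tT sT st tsd Kx Uu; apply: ltW.
  have := hd (t - s); rewrite /ball/= sub0r normrN gtr0_norm ?subr_gt0// st.
  move=> /(_ tsd isT); rewrite sub0r normrN; apply: le_lt_trans.
  apply: le_trans (ler_norm _); apply: ub_le_sup; last first.
    exists s, x, u; split => //; last by rewrite subrKC.
    by move: tT sT; rewrite !in_itv/= => /andP[? ?] /andP[? ?]; apply/andP; split; lra.
  (* An upper bound on the set is what lets [sup] dominate its elements; [sup] of an unbounded set
     is a default value. *)
  exists (Mh + Mh) => _ [r [y [v [rT Ky Uv ->]]]].
  have rT' : r \in `[0, T] /\ r + (t - s) \in `[0, T].
    by move: rT; rewrite !in_itv/= => /andP[? ?]; split; apply/andP; split; lra.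
  by apply: le_trans (ler_normB _ _) _; apply: lerD; apply: hM; case: rT'.
exists d => // t s x u tT sT; case: (ltgtP t s) => [ts|st|->].
- by rewrite distrC gtr0_norm ?subr_gt0// distrC => ? ? ?; exact: lt_case.
- by rewrite gtr0_norm ?subr_gt0// => ? ? ?; exact: lt_case.
- by rewrite !subrr normr0 => *; exact: ltW.
Qed.

(** For each control, time is changed first, at the fixed point [x] of the compact set, and space
    afterwards, by the Lipschitz bounds. Hence [y] may range over the whole space. The infimum over
    controls preserves the estimate. *)
Lemma hamiltonian_rev_modulus (X : set 'rV[R]_n) : compact X ->
  exists2 L : R, 0 < L & forall e, 0 < e -> exists2 d : R, 0 < d &
    forall (t s : R) x y p, t \in `[0, T] -> s \in `[0, T] -> `|t - s| < d ->
    X x ->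
    `|hamiltonian_rev T U f h t x p - hamiltonian_rev T U f h s y p| <=
      e + L * (1 + enorm p) * enorm (x - y).
Proof.
move=> cX; have [Lh Lh0 hL] := h_lipschitz hyp.
have [Lf Lf0 fL] := f_lipschitz hyp.
have [Mh Mh0 hM] := h_bounded hyp; have [Mf Mf0 fM] := f_bounded hyp.
exists (Lh + Lf); first exact: addr_gt0.
move=> e /(h_time_modulus_unif cX)[d d0 hd]; exists d => //.
move=> t s x y p tT sT tsd Xx.
have revT (r : R) : r \in `[0, T] -> T - r \in `[0, T].
  by rewrite !in_itv/= => /andP[? ?]; apply/andP; split; lra.
have lb (r : R) z : r \in `[0, T] ->
    has_lbound [set h r z u + dotv p (f z u) | u in U].
  move=> rT; exists (- Mh - enorm p * Mf) => _ [u Uu <-].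
  have := hM r z u rT Uu; rewrite ler_norml => /andP[h1 _].
  have := dotv_le_enorm p (f z u); rewrite ler_norml => /andP[h2 _].
  have : enorm p * enorm (f z u) <= enorm p * Mf.
    by rewrite ler_wpM2l ?enorm_ge0// fM.
  lra.
apply: inf_image_dist; [exact: (U_nonempty hyp)| exact/lb/revT| exact/lb/revT|].
move=> u Uu; rewrite opprD addrACA -dotvBr.
have h1 : `|h (T - t) x u - h (T - s) x u| <= e.
  apply: hd => //; [exact: revT| exact: revT|].
  by rewrite (_ : T - t - (T - s) = s - t) 1?distrC//; ring.
have h2 := hL (T - s) x y u (revT _ sT) Uu.
have h3 := dotv_le_enorm p (f x u - f y u).
have h4 : enorm p * enorm (f x u - f y u) <= enorm p * (Lf * enorm (x - y)).
  by rewrite ler_wpM2l ?enorm_ge0// fL.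
have h5 := enorm_ge0 (x - y).
have h6 : 0 <= Lh * (enorm p * enorm (x - y)).
  by rewrite !mulr_ge0 ?enorm_ge0// ltW.
have h7 : 0 <= Lf * enorm (x - y) by rewrite mulr_ge0// ltW.
apply: le_trans (ler_normD _ _) _.
have h8 : `|h (T - t) x u - h (T - s) y u| <= e + Lh * enorm (x - y).
  rewrite -(subrKA (h (T - s) x u)); apply: le_trans (ler_normD _ _) _.
  exact: lerD.
lra.
Qed.

End Hamiltonian.

(** * The doubled functional and existence of its maximiser *)

Section Doubling.
Context (R : realType) (n : nat) (T : R) (X : set 'rV[R]_n).
Context (A B : R * 'rV[R]_n -> R).
Hypothesis cX : compact X.
Hypothesis bucA : bounded_unif_continuous (cylinder T X) A.
Hypothesis bucB : bounded_unif_continuous (cylinder T setT) B.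

Definition doubled (k d : R) (z w : R * 'rV[R]_n) : R :=
  A z - B w - k * sqdist z (w.1 + d, w.2).

Lemma doubled_within_continuous k d (K : set 'rV[R]_n) :
  {within cylinder T X `*` cylinder T K,
    continuous (fun q => doubled k d q.1 q.2)}.
Proof.
apply/subspace_continuousP => q [qX qK].
set C := _ `*` _.
(* Continuity relative to [D], composed with a projection sending [C] into [D], gives continuity
   relative to [C]. *)
have comp (D : set (R * 'rV[R]_n)) (g : R * 'rV[R]_n -> R)
    (pr : (R * 'rV[R]_n) * (R * 'rV[R]_n) -> R * 'rV[R]_n) :
    unif_continuous (g : subspace D -> R) -> D (pr q) ->
    (forall p, C p -> D (pr p)) -> pr p @[p --> q] --> pr q ->
    g (pr p) @[p --> within C (nbhs q)] --> g (pr q).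
  move=> /unif_continuous_continuous/subspace_continuousP gc Dq CD prq.
  suff prw : pr p @[p --> within C (nbhs q)] --> within D (nbhs (pr q)).
    exact: (cvg_comp _ _ prw (gc _ Dq)).
  move=> P /prq nP; change (nbhs q (fun p => C p -> P (pr p))).
  change (nbhs q (fun p => D (pr p) -> P (pr p))) in nP.
  by move: nP; apply: filterS => p DP Cp; apply: DP; exact: CD.
apply: cvgB; first apply: cvgB.
- by apply: (comp _ _ fst bucA.2) => // [p []//|]; exact: cvg_fst.
- apply: (comp _ _ snd bucB.2) => [|p [_ []]//|]; last exact: cvg_snd.
  by case: qK.
- apply: cvg_within_filter; apply: cvgM; first exact: cvg_cst.
  have c11 : p.1.1 @[p --> q] --> q.1.1
    by apply: cvg_comp; [exact: cvg_fst|exact: cvg_fst].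
  have c12 : p.1.2 @[p --> q] --> q.1.2
    by apply: cvg_comp; [exact: cvg_fst|exact: cvg_snd].
  have c21 : p.2.1 @[p --> q] --> q.2.1
    by apply: cvg_comp; [exact: cvg_snd|exact: cvg_fst].
  have c22 : p.2.2 @[p --> q] --> q.2.2
    by apply: cvg_comp; [exact: cvg_snd|exact: cvg_snd].
  rewrite /sqdist /=; apply: cvgD.
    have c : p.1.1 - (p.2.1 + d) @[p --> q] --> q.1.1 - (q.2.1 + d).
      by apply: cvgB => //; apply: cvgD => //; exact: cvg_cst.
    exact: (cvgM c c).
  by apply: continuous_dotvv; exact: cvgB.
Qed.

Lemma compact_norm_ball (r : R) : compact [set y : 'rV[R]_n | `|y| <= r].
Proof.
apply: bounded_closed_compact.
  by exists r; split; [exact: num_real|move=> M rM y /= /le_trans; apply; exact: ltW].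
apply: (@closed_comp _ _ (fun y : 'rV[R]_n => `|y|) [set x | x <= r]).
  by move=> y _; exact: norm_continuous.
exact: closed_le.
Qed.

(** The second point ranges over an unbounded strip. Far from [X], replacing its space component by
    that of [z] changes [B] by at most [2 M] and saves a larger penalty, so a maximum over a compact
    ball is global. *)
Lemma doubled_attains_max (k d : R) : 0 < k -> 0 <= T -> X !=set0 ->
  exists zb wb, [/\ cylinder T X zb, cylinder T setT wb &
    forall z w, cylinder T X z -> cylinder T setT w ->
      doubled k d z w <= doubled k d zb wb].
Proof.
move=> k0 T0 [x0 Xx0].
have [M M0 BM] := bounded_onP bucB.1.
have [r0 r00 Xr0] : exists2 r0 : R, 0 < r0 & forall x, X x -> `|x| <= r0.
  by have /pinfty_ex_gt0[r0 ? ?] := compact_bounded cX; exists r0.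
(* Chosen so that [k r^2 >= 2 M]: as [r >= 1], [k r^2 >= k r >= k (r - 1) = 2 M]. *)
pose r := (M + M) / k + 1.
have kr : M + M <= k * (r * r).
  have r1 : 1 <= r by rewrite lerDr divr_ge0// ltW// addr_gt0.
  have -> : M + M = k * (r - 1) by rewrite /r; field; rewrite gt_eqF.
  rewrite ler_pM2l//; have := @ler_pM _ 1 r r r ler01 (le_trans ler01 r1) r1 (lexx _).
  lra.
(* Contains [X], and every point outside [K] is at distance at least [r] from [X]. *)
pose K := [set y : 'rV[R]_n | `|y| <= r0 + r].
have r_ge0 : 0 <= r by rewrite addr_ge0// divr_ge0// ltW// addr_gt0.
have XK : X `<=` K by move=> x /Xr0 /= xr0; rewrite /K/=; lra.
have T0T : (0 : R) \in `[0, T] by rewrite in_itv/= lexx.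
have [||[zb wb]] := @compact_EVT_max _ _ (fun q => doubled k d q.1 q.2)
  (cylinder T X `*` cylinder T K) _ _ (@doubled_within_continuous k d K).
- by exists ((0, x0), (0, x0)); split; split => //; exact: XK.
- apply: compact_setX; apply: compact_setX => //; try exact: segment_compact.
  exact: compact_norm_ball.
rewrite inE => -[/= zbX [wbT wbK]] maxP.
exists zb, wb; split => // z w zX [wT _].
have [wK|wK] := pselect (K w.2).
  by apply: (maxP (z, w)); rewrite inE; split.
have zXX : X z.2 by case: zX.
have : doubled k d z (w.1, z.2) <= doubled k d zb wb.
  by apply: (maxP (z, (w.1, z.2))); rewrite inE; split => //; split => //; exact: XK.
apply: le_trans; rewrite /doubled [in leRHS]sqdist_same_point// /sqdist /=.
have rw : r <= enorm (z.2 - w.2).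
  apply: le_trans (norm_le_enorm _).
  move/negP: wK; rewrite /K /= -ltNge => wK.
  have := ler_distD z.2 0 w.2; rewrite !sub0r !normrN.
  have := Xr0 _ zXX; lra.
have : k * (r * r) <= k * dotv (z.2 - w.2) (z.2 - w.2).
  by rewrite ler_pM2l// -enorm_sqr expr2 ler_pM.
have := BM w (conj wT I).
have := BM (w.1, z.2) (conj wT I).
rewrite !ler_norml => /andP[? ?] /andP[? ?]; lra.
Qed.

End Doubling.

(** * Comparison principle for an abstract Hamiltonian, to be applied to both signs *)

Section Comparison.
Context (R : realType) (n : nat) (T lambda eps eps0 L : R) (X : set 'rV[R]_n).
Context (A B : R * 'rV[R]_n -> R) (G : R -> 'rV[R]_n -> 'rV[R]_n -> R).
Hypothesis T0 : 0 < T.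
Hypothesis lambda0 : 0 < lambda.
Hypothesis L0 : 0 < L.
Hypothesis cX : compact X.
Hypothesis bucA : bounded_unif_continuous (cylinder T X) A.
Hypothesis bucB : bounded_unif_continuous (cylinder T setT) B.
Hypothesis G_modulus : forall e, 0 < e -> exists2 d : R, 0 < d &
  forall (t s : R) x y p, t \in `[0, T] -> s \in `[0, T] -> `|t - s| < d ->
    X x -> `|G t x p - G s y p| <= e + L * (1 + enorm p) * enorm (x - y).
(** The subsolution inequality, asked only of paraboloids touching [A] from above; [B_super] is its
    counterpart with paraboloids touching [B] from below, whence the opposite sign of the
    derivatives. *)
Hypothesis A_sub : forall k w z0, cylinder T X z0 -> 0 < z0.1 ->
  (forall z, cylinder T X z ->
     A z - k * sqdist z w <= A z0 - k * sqdist z0 w) ->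
  2 * k * (z0.1 - w.1) - G z0.1 z0.2 ((2 * k) *: (z0.2 - w.2)) + lambda * A z0
    <= eps.
Hypothesis B_super : forall k w z0, z0.1 \in `]0, T[ ->
  (forall z, cylinder T setT z ->
     B z0 + k * sqdist z0 w <= B z + k * sqdist z w) ->
  0 <= - (2 * k * (z0.1 - w.1)) - G z0.1 z0.2 (- ((2 * k) *: (z0.2 - w.2)))
    + lambda * B z0.
Hypothesis A_init : forall x, X x -> A (0, x) <= eps0.
Hypothesis B_init : forall x, B (0, x) = 0.

(* The penalty is centred at tau - s = d rather than at tau = s: its maximiser
   then has s < tau <= T, so B is never tested at the terminal time, where
   it is not known to be a supersolution. *)
Lemma doubled_max_close (e : R) : 0 < e -> X !=set0 ->
  exists2 d0 : R, 0 < d0 & forall d, 0 < d -> d <= d0 -> exists k zb wb,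
   [/\ 0 < k, cylinder T X zb, cylinder T setT wb,
       forall z w, cylinder T X z -> cylinder T setT w ->
         doubled A B k d z w <= doubled A B k d zb wb &
       [/\ `|zb.1 - wb.1 - d| < d, enorm (zb.2 - wb.2) < d &
           k * enorm (zb.2 - wb.2) ^+ 2 <= e]].
Proof.
move=> e0 [x0 Xx0].
have [dB dB0 ucB] := unif_continuous_onP bucB.2 e0.
have [MA MA0 AM] := bounded_onP bucA.1.
have [MB MB0 BM] := bounded_onP bucB.1.
exists (Num.min T dB); first by rewrite lt_min T0.
move=> d d0; rewrite le_min => /andP[dT ddB].
(* Makes [k d^2] exceed [2 MA + 2 MB], a bound on the oscillation of [A - B]. *)
pose k := (2 * MA + 2 * MB) / d ^+ 2 + 1.
have d20 : 0 < d ^+ 2 by rewrite exprn_gt0.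
have k0 : 0 < k by rewrite /k ltr_wpDl// divr_ge0// ?(ltW d20)//; lra.
have kd : k * d ^+ 2 = 2 * MA + 2 * MB + d ^+ 2.
  by rewrite /k; field; rewrite gt_eqF.
have [|zb [wb [zbX wbT zbmax]]] :=
  doubled_attains_max cX bucA bucB d k0 (ltW T0); first by exists x0.
exists k, zb, wb; split => //.
have dist_lt : sqdist zb (wb.1 + d, wb.2) < d ^+ 2.
  (* The pair [(d, x0)], [(0, x0)] has zero penalty; maximality against it bounds the penalty at the
     maximiser by [2 MA + 2 MB]. *)
  have dcyl : cylinder T X (d, x0).
    by split => //=; rewrite in_itv/= dT ltW.
  have ocyl : cylinder T setT (0, x0) by split => //=; rewrite in_itv/= lexx ltW.
  have := zbmax _ _ dcyl ocyl.
  rewrite /doubled sqdist_same_point//= add0r subrr expr0n/= mulr0 subr0.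
  rewrite -(ltr_pM2l k0) kd.
  have := AM _ dcyl; have := AM _ zbX; have := BM _ ocyl; have := BM _ wbT.
  rewrite !ler_norml => /andP[? ?] /andP[? ?] /andP[? ?] /andP[? ?].
  lra.
have := dotvv_ge0 (zb.2 - wb.2); rewrite -enorm_sqr => enorm2_ge0.
have := sqr_ge0 (zb.1 - wb.1 - d) => time2_ge0.
move: dist_lt; rewrite /sqdist/= opprD addrA -enorm_sqr => dist_lt.
have edist : enorm (zb.2 - wb.2) < d.
  by rewrite -ltr_sqr ?nnegrE ?enorm_ge0 1?ltW//; lra.
split => //.
  by rewrite -ltr_sqr ?nnegrE ?normr_ge0 1?ltW// real_normK ?num_real//; lra.
(* Moving only the space component of [wb] onto that of [zb] removes the spatial penalty, which is
   thus at most an increment of [B], hence at most [e]. *)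
have wcyl : cylinder T setT (wb.1, zb.2) by split => //; case: wbT.
have := zbmax _ _ zbX wcyl.
rewrite /doubled (@sqdist_same_point _ _ zb)// /sqdist/= opprD addrA -enorm_sqr.
have := ucB _ _ wcyl wbT; rewrite /= subrr normr0.
move=> /(_ dB0 (lt_le_trans edist ddB)); rewrite ltr_norml => /andP[_ ?].
lra.
Qed.

(** One [e] is lost in passing from [z0] to the maximiser. If [s = 0], another comes from the
    modulus of [A]; if [s > 0], the Hamiltonian modulus costs [(2 + 2 L) e], divided by [lambda]. *)
Lemma comparison_approx (e : R) z0 : 0 < e -> cylinder T X z0 -> 0 < z0.1 ->
  A z0 - B z0 <=
    Num.max (eps / lambda) eps0 + (2 + (2 + 2 * L) / lambda) * e.
Proof.
move=> e0 z0X z00; have X0 : X !=set0 by exists z0.2; case: z0X.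
have [d1 d10 close] := doubled_max_close e0 X0.
have [dG dG0 Gd] := G_modulus e0.
have [dA dA0 ucA] := unif_continuous_onP bucA.2 e0.
have [dB dB0 ucB] := unif_continuous_onP bucB.2 e0.
(* The maximiser has [tau - s < 2 d], whence the halves of [dG] and [dA]; [e / L] controls
   [L |x - y|]; [z0.1] keeps [z0.1 - d] nonnegative. *)
pose d := Num.min (Num.min d1 (Num.min (dG / 2) (dA / 2)))
            (Num.min (dB / 2) (Num.min (e / L) z0.1)).
have d0 : 0 < d by rewrite !lt_min z00 d10 !divr_gt0.
have [[dd1 [ddG ddA]] [ddB [deL dz0]]] :
    (d <= d1 /\ d <= dG / 2 /\ d <= dA / 2) /\
    (d <= dB / 2 /\ d <= e / L /\ d <= z0.1).
  have : d <= d by [].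
  by rewrite {2}/d !le_min => /andP[/and3P[? ? ?] /and3P[? ? ?]].
have Lde : L * d <= e by rewrite mulrC -ler_pdivlMr.
have [k [zb [wb [k0 zbX wbT zbmax [tdist xdist kdist]]]]] := close d d0 dd1.
have [zbT wbT'] : zb.1 \in `[0, T] /\ wb.1 \in `[0, T].
  by case: zbX wbT => ? _ [].
have zbXx : X zb.2 by case: zbX.
have := zbT; have := wbT'; rewrite !in_itv/= => /andP[wb_ge0 wb_leT] /andP[zb_ge0 zb_leT].
(* Maximality against [z0] paired with its backward time shift by [d], which has zero penalty. *)
have start : A z0 - B z0 <= A zb - B wb + e.
  have wcyl : cylinder T setT (z0.1 - d, z0.2).
    have z0T : z0.1 \in `[0, T] by case: z0X.
    move: z0T; rewrite in_itv/= => /andP[? ?]; split => //=.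
    by rewrite in_itv/=; apply/andP; split; lra.
  have z0cyl : cylinder T setT z0 by case: z0X; split.
  have := zbmax _ _ z0X wcyl.
  rewrite /doubled (@sqdist_same_point _ _ z0)//= subrK subrr expr0n/=.
  have : 0 <= k * sqdist zb (wb.1 + d, wb.2) by rewrite mulr_ge0 ?sqdist_ge0// ltW.
  have := ucB _ _ wcyl z0cyl; rewrite /= addrAC subrr add0r normrN subrr.
  rewrite gtr0_norm// enorm0.
  have dltB : d < dB by lra.
  move=> /(_ dltB dB0); rewrite ltr_norml => /andP[? ?].
  lra.
have tsmall : 0 < zb.1 - wb.1 < 2 * d.
  by move: tdist; rewrite ltr_norml => /andP[? ?]; apply/andP; split; lra.
case/andP: tsmall => ts_gt0 ts_lt.
have C0 : 0 <= (2 + 2 * L) / lambda.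
  by rewrite divr_ge0 ?(ltW lambda0)// addr_ge0// mulr_ge0// ltW.
have Ce : 0 <= (2 + 2 * L) / lambda * e by rewrite mulr_ge0// ltW.
have [max1 max2] : eps / lambda <= Num.max (eps / lambda) eps0 /\
    eps0 <= Num.max (eps / lambda) eps0 by rewrite !le_max !lexx orbT.
apply: (le_trans start); case: (ltP 0 wb.1) => [wb_gt0|wb_le0]; last first.
  have wb10 : wb.1 = 0 by apply/eqP; rewrite eq_le wb_le0.
  have -> : B wb = 0 by rewrite (surjective_pairing wb) wb10.
  have ocyl : cylinder T X (0, zb.2) by split => //=; rewrite in_itv/= lexx ltW.
  have := ucA _ _ zbX ocyl; rewrite /= subr0 subrr gtr0_norm; last by lra.
  rewrite enorm0.
  have tltA : zb.1 < dA by lra.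
  move=> /(_ tltA dA0); rewrite ltr_norml => /andP[_ ?].
  have := A_init zbXx.
  lra.
have zb_gt0 : 0 < zb.1 by lra.
have subA := @A_sub k (wb.1 + d, wb.2) zb zbX zb_gt0.
have supB := @B_super k (zb.1 - d, zb.2) wb.
have {}subA : 2 * k * (zb.1 - (wb.1 + d)) -
    G zb.1 zb.2 ((2 * k) *: (zb.2 - wb.2)) + lambda * A zb <= eps.
  by apply: subA => z zX; have := zbmax _ _ zX wbT; rewrite /doubled; lra.
have sym z w : sqdist z (w.1 + d, w.2) = sqdist w (z.1 - d, z.2).
  rewrite /sqdist/= -[w.2 - z.2]opprB -!enorm_sqr enormN; ring.
have {}supB : 0 <= - (2 * k * (wb.1 - (zb.1 - d))) -
    G wb.1 wb.2 ((2 * k) *: (zb.2 - wb.2)) + lambda * B wb.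
  rewrite -[zb.2 - wb.2]opprB scalerN; apply: supB.
    by rewrite in_itv/=; apply/andP; split; lra.
  move=> w wT; have := zbmax _ _ zbX wT; rewrite /doubled !sym; lra.
(* Both inequalities carry the same time term [2 k (tau - s - d)] and the same momentum; on
   subtraction only the difference of the values of [G] remains. *)
have := Gd zb.1 wb.1 zb.2 wb.2 ((2 * k) *: (zb.2 - wb.2)) zbT wbT'.
have tltG : `|zb.1 - wb.1| < dG by rewrite gtr0_norm//; lra.
move=> /(_ tltG zbXx); rewrite ler_norml => /andP[_ Gd1].
move: Gd1; rewrite enormZ gtr0_norm ?mulr_gt0//.
set r := enorm _ in xdist kdist *.
rewrite (_ : L * (1 + 2 * k * r) * r = L * r + 2 * L * (k * r ^+ 2)); last by ring.
(* The momentum term is harmless because [k r^2 <= e], although [k] itself is large. *)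
have : L * (k * r ^+ 2) <= L * e by rewrite ler_pM2l.
have : L * r <= L * d by rewrite ler_pM2l// ltW.
move=> Lr Lk Gd1.
have : A zb - B wb <= eps / lambda + (2 + 2 * L) / lambda * e.
  rewrite -(ler_pM2l lambda0).
  rewrite (_ : lambda * (eps / lambda + _) = eps + (2 + 2 * L) * e); first by lra.
  by field; rewrite gt_eqF.
lra.
Qed.

Lemma comparison z : cylinder T X z -> A z - B z <= Num.max (eps / lambda) eps0.
Proof.
move=> zX; have [/andP[z_ge0 _]] : z.1 \in `[0, T] /\ X z.2 by [].
move: z_ge0; rewrite bnd_simp le_eqVlt => /orP[/eqP z0 Xz|z_gt0 _].
  rewrite (surjective_pairing z) -z0 B_init subr0 le_max; apply/orP; right.
  exact: A_init.
apply/ler_addgt0Pr => e e0.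
pose C := 2 + (2 + 2 * L) / lambda.
have C0 : 0 < C by rewrite addr_gt0// divr_gt0// addr_gt0// mulr_gt0.
have := comparison_approx (divr_gt0 e0 C0) zX z_gt0.
by rewrite -/C mulrCA divff ?gt_eqF// mulr1.
Qed.

End Comparison.

(** * Touching paraboloids and transfer of bounds to the norm *)

Section Touching.
Context (R : realType) (n m : nat) (T lambda : R) (U : set 'rV[R]_m)
  (f : 'rV[R]_n -> 'rV[R]_m -> 'rV[R]_n)
  (h : R -> 'rV[R]_n -> 'rV[R]_m -> R).
Hypothesis T0 : 0 < T.

(** The constant makes the paraboloid meet [g] at [z0]; [k] of either sign is allowed, serving tests
    from above and from below. *)
Definition touching (g : R * 'rV[R]_n -> R) (k : R) (w z0 z : R * 'rV[R]_n) : R :=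
  g z0 - k * sqdist z0 w + k * sqdist z w.

Lemma touching_C1 g k w z0 : C1_strip T (touching g k w z0).
Proof. exact: C1_strip_quadratic. Qed.

Lemma touching_at g k w z0 : touching g k w z0 z0 = g z0.
Proof. by rewrite /touching subrK. Qed.

Lemma touching_residual g k w z0 : z0.1 \in `[0, T] ->
  pde_residual T lambda U f h (touching g k w z0) z0 =
  2 * k * (z0.1 - w.1)
    - hamiltonian_rev T U f h z0.1 z0.2 ((2 * k) *: (z0.2 - w.2))
    + lambda * g z0.
Proof.
by move=> z0T; rewrite /pde_residual touching_at dtime_quadratic// grad_quadratic.
Qed.

End Touching.

Lemma bounded_unif_continuousN (R : realType) (n : nat)
    (A : set (R * 'rV[R]_n)) (g : R * 'rV[R]_n -> R) :
  bounded_unif_continuous A g -> bounded_unif_continuous A (fun z => - g z).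
Proof.
move=> [/bounded_onP[M M0 gM] gu]; split.
  exists M; split; first exact: num_real.
  by move=> N MN z Az /=; rewrite normrN; apply: le_trans (gM z Az) (ltW MN).
apply/unif_continuousP => e e0; have [d d0 gd] := (unif_continuousP _).1 gu e e0.
exists d => // x /gd; rewrite /ball/= => ge.
by rewrite -opprD normrN.
Qed.

Lemma Linfty_norm_le (R : realType) (n : nat) (A : set (R * 'rV[R]_n))
    (g : R * 'rV[R]_n -> R) (c : R) :
  0 <= c -> (forall z, A z -> `|g z| <= c) -> (Linfty_norm A g <= c%:E)%E.
Proof.
move=> c0 gc; apply: ereal_inf_lbound; exists c => //; split => // e e0.
(* The exceptional set is empty, so degenerate boxes of zero volume cover it. *)
exists (fun=> (0, 0)), (fun=> (0, 0)); split => //.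
- by move=> z [/gc]; rewrite leNgt => /negP.
- rewrite eseries0 ?lee_fin ?ltW// => k _ _.
  by rewrite /box_volume/= subrr mul0r.
Qed.

Lemma global_max_local (R : realType) (n : nat) (A : set (R * 'rV[R]_n))
    (g : R * 'rV[R]_n -> R) z0 :
  (forall z, A z -> g z <= g z0) -> local_max_on A g z0.
Proof. by move=> gz0; exact: (@filterE _ (nbhs z0)). Qed.

Lemma global_min_local (R : realType) (n : nat) (A : set (R * 'rV[R]_n))
    (g : R * 'rV[R]_n -> R) z0 :
  (forall z, A z -> g z0 <= g z) -> local_min_on A g z0.
Proof. by move=> gz0; exact: (@filterE _ (nbhs z0)). Qed.

(** * The two-sided error bound *)

Theorem theorem3 (R : realType) (n m : nat) (T lambda : R)
    (U : set 'rV[R]_m) (f : 'rV[R]_n -> 'rV[R]_m -> 'rV[R]_n)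
    (h : R -> 'rV[R]_n -> 'rV[R]_m -> R) (X : set 'rV[R]_n)
    (W What : R * 'rV[R]_n -> R) (eps_pde eps_0 : R) :
  0 < T -> 0 < lambda ->
  standing_assumptions T U f h ->
  compact X ->
  bounded_unif_continuous (cylinder T setT) W ->
  viscosity_solution T lambda U f h W ->
  bounded_unif_continuous (cylinder T X) What ->
  0 <= eps_pde -> 0 <= eps_0 ->
  (forall (phi : R * 'rV[R]_n -> R) (z0 : R * 'rV[R]_n),
     C1_strip T phi -> z0.1 \in `]0, T] -> X z0.2 -> phi z0 = What z0 ->
     (local_max_on (cylinder T X) (fun z => What z - phi z) z0 ->
        pde_residual T lambda U f h phi z0 <= eps_pde) /\
     (local_min_on (cylinder T X) (fun z => What z - phi z) z0 ->
        - eps_pde <= pde_residual T lambda U f h phi z0)) ->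
  sup [set `|What (0, x)| | x in X] <= eps_0 ->
  let eps_val := Num.max (eps_pde / lambda) eps_0 in
  (forall z, cylinder T X z ->
     What z - eps_val <= W z /\ W z <= What z + eps_val) /\
  (Linfty_norm (cylinder T X) (fun z => What z - W z)%R <= eps_val%:E)%E.
Proof.
move=> T0 lambda0 hyp cX bucW [W_init W_visc] bucWhat eps_pde0 eps_00 What_visc
  What_init eps_val.
have [L L0 H_mod] := hamiltonian_rev_modulus hyp cX.
have What0 x : X x -> `|What (0, x)| <= eps_0.
  move=> Xx; apply: le_trans What_init; apply: ub_le_sup; last by exists x.
  have [M M0 WM] := bounded_onP bucWhat.1.
  exists M => _ [y Xy <-]; apply: WM; split => //=.
  by rewrite in_itv/= lexx ltW.
have cylT (D : set 'rV[R]_n) z : cylinder T D z -> 0 < z.1 -> z.1 \in `]0, T].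
  move=> [zT _] z0; have : z.1 \in `[0, T] by [].
  by rewrite !in_itv/= z0 => /andP[].
have oo_cc (t : R) : t \in `]0, T[ -> t \in `[0, T].
  exact: subset_itv_oo_cc.
have upper z : cylinder T X z -> What z - W z <= eps_val.
  apply: (@comparison _ _ T lambda eps_pde eps_0 L X What W
    (hamiltonian_rev T U f h)) => //.
  - move=> k w z0 z0X z0_gt0 z0max.
    rewrite -(touching_residual lambda U f h T0) ?(proj1 z0X)//.
    apply: (proj1 (What_visc _ z0 (touching_C1 T0 _ _ _ _) (cylT _ _ z0X z0_gt0)
      (proj2 z0X) (touching_at _ _ _ _))).
    by apply: global_max_local => x xX; have := z0max x xX; rewrite /touching; lra.
  - move=> k w z0 z0T z0min.
    (* A paraboloid touching [W] from below has coefficient [- k]. *)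
    have := touching_residual lambda U f h T0 W (- k) w (oo_cc _ z0T).
    rewrite mulrN mulNr scaleNr => <-.
    apply: (proj2 (W_visc _ z0 (touching_C1 T0 _ _ _ _) z0T
      (touching_at _ _ _ _))).
    by apply: global_min_local => x xX; have := z0min x xX; rewrite /touching; lra.
  - by move=> x /What0; rewrite ler_norml => /andP[].
(* Negation swaps sub- and supersolutions, so the same comparison applies to the negated functions
   with the reflected Hamiltonian. *)
have lower z : cylinder T X z -> - What z - - W z <= eps_val.
  apply: (@comparison _ _ T lambda eps_pde eps_0 L X
    (fun z => - What z) (fun z => - W z)
    (fun t x p => - hamiltonian_rev T U f h t x (- p))) => //.
  - exact: bounded_unif_continuousN.
  - exact: bounded_unif_continuousN.
  - move=> e /H_mod[d d0 Hd]; exists d => // t s x y p tT sT ts Xx.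
    have := Hd t s x y (- p) tT sT ts Xx.
    move: (hamiltonian_rev _ _ _ _ t _ _) (hamiltonian_rev _ _ _ _ s _ _) => a b.
    by rewrite enormN -[- a - - b]opprD normrN.
  - move=> k w z0 z0X z0_gt0 z0max.
    (* A maximum of [- What - k sqdist] is a minimum of [What + k sqdist], so the lower test on
       [What] applies with coefficient [- k]. *)
    have := proj2 (What_visc _ z0 (touching_C1 T0 What (- k) w z0)
      (cylT _ _ z0X z0_gt0) (proj2 z0X) (touching_at _ _ _ _)).
    rewrite touching_residual ?(proj1 z0X)// mulrN mulNr scaleNr.
    suff z0min : local_min_on (cylinder T X)
        (fun z => What z - touching What (- k) w z0 z) z0.
      by move=> /(_ z0min); lra.
    by apply: global_min_local => x xX; have := z0max x xX; rewrite /touching; lra.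
  - move=> k w z0 z0T z0min.
    have := proj1 (W_visc _ z0 (touching_C1 T0 W k w z0) z0T
      (touching_at _ _ _ _)).
    rewrite touching_residual ?oo_cc// [- - (_ *: _)]opprK.
    suff z0max : local_max_on (cylinder T setT)
        (fun z => W z - touching W k w z0 z) z0.
      by move=> /(_ z0max); lra.
    by apply: global_max_local => x xX; have := z0min x xX; rewrite /touching; lra.
  - by move=> x /What0; rewrite ler_norml => /andP[? ?]; lra.
  - by move=> x; rewrite W_init oppr0.
split.
  by move=> z zX; have := upper z zX; have := lower z zX; split; lra.
apply: Linfty_norm_le => [|z zX]; first by rewrite le_max eps_00 orbT.
by have := upper z zX; have := lower z zX; rewrite ler_norml => *; apply/andP; split; lra.
Qed.
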